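(* Let $n\ge1$ and let $\sigma:P_n(\mathbb{C})\to P_n(\mathbb{C})$ be an origin-preserving polynomial symplectomorphism over the complex numbers. Then there exists a sequence $\psi_1,\psi_2,\ldots,\psi_k,\ldots$ of tame automorphisms of the $n$-th Weyl algebra $W_n(\mathbb{C})$ such that their images $\sigma_k$ in $\operatorname{Aut}P_n(\mathbb{C})$ (under the isomorphism $\operatorname{TAut}W_n(\mathbb{C})\to\operatorname{TAut}P_n(\mathbb{C})$) converge to $\sigma$ in the formal power series topology.
   Context: $P_n(\mathbb{C})$ is the polynomial algebra $\mathbb{C}[x_1,\ldots,x_n,p_1,\ldots,p_n]$ with the Poisson bracket determined by $\{x_i,x_j\}=0$, $\{p_i,p_j\}=0$, $\{p_i,x_j\}=\delta_{ij}$. A polynomial symplectomorphism is a $\mathbb{C}$-algebra automorphism of $P_n(\mathbb{C})$ preserving the Poisson bracket; it is origin-preserving if the images of all generators have zero constant term. The $n$-th Weyl algebra $W_n(\mathbb{C})$ is generated by $\hat x_1,\dots,\hat x_n,\hat p_1,\dots,\hat p_n$ with relations $[\hat x_i,\hat x_j]=[\hat p_i,\hat p_j]=0$, $[\hat p_i,\hat x_j]=\delta_{ij}$. $\operatorname{TAut}P_n(\mathbb{C})$ is the group generated by linear symplectic changes of the $2n$ generators (by matrices in $\operatorname{Sp}(2n,\mathbb{C})$) and by the elementary origin-preserving automorphisms (those changing only one generator, $z_k\mapsto a z_k+f$ with $a\in\mathbb{C}^\times$ and $f$ not involving $z_k$) that preserve the Poisson bracket. $\operatorname{TAut}W_n(\mathbb{C})$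 is the subgroup of $\operatorname{Aut}W_n(\mathbb{C})$ generated by automorphisms of exactly the same form in the generators $\hat x_i,\hat p_i$. It is known (Kanel-Belov and Kontsevich) that there is a group isomorphism $\operatorname{TAut}W_n(\mathbb{C})\to\operatorname{TAut}P_n(\mathbb{C})$ sending each such generating automorphism to the one given by the same formula, with $\hat x_i,\hat p_i$ replaced by $x_i,p_i$. Topology on $\operatorname{Aut} P_n(\mathbb{C})$: the height $\operatorname{Ht}(f)$ of a polynomial is the smallest $k$ such that its homogeneous component of total degree $k$ is nonzero ($\operatorname{Ht}(0)=\infty$); the height of a tuple is the minimum of heights of its entries; the metric is $d(\varphi,\psi)=\exp(-\operatorname{Ht}(\varphi-\psi))$, where endomorphisms are identified with tuples of images of generators. *)

(* Defs.v *)
From HB Require Import structures.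
From mathcomp Require Import all_boot all_order all_algebra.
From mathcomp Require Import finmap.
(* The notations of monalg and mpoly clash with those of mathcomp-analysis. *)
From mathcomp Require Import -(notations) monalg.
From mathcomp Require Import -(notations) mpoly.
From mathcomp Require Import complex.
From mathcomp Require Import all_classical all_reals all_analysis.

Set Implicit Arguments.
Unset Strict Implicit.
Unset Printing Implicit Defensive.

Import Order.TTheory GRing.Theory Num.Theory.
Import numFieldNormedType.Exports.
Local Open Scope ring_scope.
Local Open Scope quotient_scope.

(* Indices in 'I_(n + n) number the generators (z_i): lshift n i stands for
   x_i and rshift n i for p_i, in P_n as well as in W_n. *)

(* W_n(K) is the quotient of the free associative algebra on 2n letters by the
   two-sided ideal generated by the Weyl relators. *)
Section WeylAlgebra.
Variables (K : fieldType) (n : nat).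

Definition free_alg : Type := malg (fmonom 'I_(n + n)) K.
HB.instance Definition _ := GRing.Lalgebra.on free_alg.

Definition free_gen (i : 'I_(n + n)) : free_alg := mkmalgU (fmu i) 1.

Local Notation X i := (free_gen (lshift n i)).
Local Notation P i := (free_gen (rshift n i)).

Variant weyl_relator : free_alg -> Prop :=
| weyl_relator_xx i j : weyl_relator (X i * X j - X j * X i)
| weyl_relator_pp i j : weyl_relator (P i * P j - P j * P i)
| weyl_relator_px i j : weyl_relator (P i * X j - X j * P i - (i == j)%:R).

Inductive weyl_ideal : free_alg -> Prop :=
| weyl_ideal0 : weyl_ideal 0
| weyl_idealD a b : weyl_ideal a -> weyl_ideal b -> weyl_ideal (a + b)
| weyl_ideal_rel a r b : weyl_relator r -> weyl_ideal (a * r * b).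

Definition weyl_ideal_pred : {pred free_alg} := fun a => `[< weyl_ideal a >].

Lemma weyl_idealP a : reflect (weyl_ideal a) (a \in weyl_ideal_pred).
Proof. exact: asboolP. Qed.

Lemma weyl_idealN a : weyl_ideal a -> weyl_ideal (- a).
Proof.
elim=> [|b c _ Ib _ Ic|b r c rel]; first by rewrite oppr0; constructor.
- by rewrite opprD; constructor.
- by rewrite -!mulNr; constructor.
Qed.

Lemma weyl_idealMl a b : weyl_ideal b -> weyl_ideal (a * b).
Proof.
elim=> [|c d _ Ic _ Id|c r d rel]; first by rewrite mulr0; constructor.
- by rewrite mulrDr; constructor.
- by rewrite !mulrA; constructor.
Qed.

Lemma weyl_idealMr a b : weyl_ideal a -> weyl_ideal (a * b).
Proof.
elim=> [|c d _ Ic _ Id|c r d rel]; first by rewrite mul0r; constructor.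
- by rewrite mulrDl; constructor.
- by rewrite -[_ * _ * b]mulrA; constructor.
Qed.

Lemma weyl_ideal_zmod_closed : zmod_closed weyl_ideal_pred.
Proof.
split=> [|a b /weyl_idealP Ia /weyl_idealP Ib]; apply/weyl_idealP.
  by constructor.
by constructor=> //; apply: weyl_idealN.
Qed.

HB.instance Definition _ :=
  GRing.isZmodClosed.Build free_alg weyl_ideal_pred weyl_ideal_zmod_closed.

(* Nontriviality of the quotient: free_alg acts on K[t_1..t_n] with x_i acting
   as multiplication by t_i and p_i as d/dt_i, and weyl_ideal acts by zero. *)
Let V := mpoly n K.

Let op (i : 'I_(n + n)) (v : V) : V :=
  match fintype.split i with
  | inl j => mpolyX K (mnm1 j) * v
  | inr j => mderiv j v
  end.

Let opD i u v : op i (u + v) = op i u + op i v.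
Proof. by rewrite /op; case: fintype.split => j; rewrite (mulrDr, mderivD). Qed.

Let opZ i c v : op i (c *: v) = c *: op i v.
Proof. by rewrite /op; case: fintype.split => j; rewrite (scalerAr, mderivZ). Qed.

Let word (s : seq 'I_(n + n)) (v : V) : V := foldr op v s.

Let wordD s u v : word s (u + v) = word s u + word s v.
Proof. by elim: s => //= i s ->; rewrite opD. Qed.

Let wordZ s c v : word s (c *: v) = c *: word s v.
Proof. by elim: s => //= i s ->; rewrite opZ. Qed.

Let word0 s : word s 0 = 0.
Proof. by rewrite -[0 in LHS](scale0r 0) wordZ scale0r. Qed.

Let act (g : free_alg) (v : V) : V :=
  \sum_(k <- monalg.msupp g) monalg.mcoeff k g *: word k v.

Let actEw (d : {fset fmonom _}) g v : (monalg.msupp g `<=` d)%fset ->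
  act g v = \sum_(k <- d) monalg.mcoeff k g *: word k v.
Proof.
move=> le_d; apply: big_fset_incl => // k _ /monalg.mcoeff_outdom ->.
by rewrite scale0r.
Qed.

Let actD a b v : act (a + b) v = act a v + act b v.
Proof.
rewrite (actEw _ (monalg.msuppD_le a b)).
rewrite (actEw _ (fsubsetUl (monalg.msupp a) (monalg.msupp b))).
rewrite (actEw _ (fsubsetUr (monalg.msupp a) (monalg.msupp b))).
rewrite -big_split; apply: eq_bigr => k _ /=.
by rewrite monalg.mcoeffD scalerDl.
Qed.

Let act0 v : act 0 v = 0.
Proof. by apply: (addIr (act 0 v)); rewrite -actD !add0r. Qed.

Let actU c k v : act (mkmalgU k c) v = c *: word k v.
Proof.
by rewrite (actEw _ monalg.msuppU_le) big_seq_fset1 monalg.mcoeffUU.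
Qed.

Let act_r0 g : act g 0 = 0.
Proof. by rewrite /act big1 // => k _; rewrite word0 scaler0. Qed.

Let actM a b v : act (a * b) v = act a (act b v).
Proof.
rewrite malgME (big_morph (act^~ v) (fun x y => actD x y v) (act0 v)).
apply: eq_bigr => k1 _.
rewrite (big_morph (act^~ v) (fun x y => actD x y v) (act0 v)).
rewrite [act b v]/act (big_morph (word k1) (wordD k1) (word0 k1)) scaler_sumr.
apply: eq_bigr => k2 _; rewrite actU wordZ scalerA.
congr (_ *: _); rewrite /mmul /= fmmulE /= /word foldr_cat //.
Qed.

Let actN a v : act (- a) v = - act a v.
Proof. by apply: (addIr (act a v)); rewrite -actD !addNr act0. Qed.

Let act1 v : act 1 v = v.
Proof. by rewrite actU scale1r /mone /= fmoneE. Qed.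

Let act_gen i v : act (free_gen i) v = op i v.
Proof. by rewrite actU scale1r fmuE. Qed.

Let act_rel r v : weyl_relator r -> act r v = 0.
Proof.
have opl (j : 'I_n) u : op (lshift n j) u = mpolyX K (mnm1 j) * u.
  by rewrite /op -[lshift n j]/(unsplit (inl j)) unsplitK.
have opr (j : 'I_n) u : op (rshift n j) u = mderiv j u.
  by rewrite /op -[rshift n j]/(unsplit (inr j)) unsplitK.
case=> i j; rewrite !(actD, actN, actM, act_gen, opl, opr).
- by rewrite mulrCA subrr.
- by rewrite mderiv_comm subrr.
rewrite mderivM mderivX mnmE eq_sym.
case: eqVneq => [->|_]; last by rewrite scale0r mul0r add0r act0 subr0 subrr.
have -> : mnm_sub (mnm1 j) (mnm1 j) = mnm0 :> multinom n.
  by apply/mnmP => k; rewrite mnmBE mnm0E subnn.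
by rewrite scale1r mpolyX0 mul1r act1 addrK subrr.
Qed.

Lemma weyl_ideal1 : 1 \notin weyl_ideal_pred.
Proof.
apply/negP => /weyl_idealP I1; suff: act 1 1 = 0.
  by rewrite act1; apply/eqP; rewrite oner_eq0.
elim: I1 (1 : V) => [|a b _ IHa _ IHb|a r b rel] v; first exact: act0.
  by rewrite actD IHa IHb addr0.
by rewrite !actM (act_rel _ rel) act_r0.
Qed.

Let free_scaleAr (c : K) (a b : free_alg) : c *: (a * b) = a * (c *: b).
Proof.
pose mc : free_alg := mkmalgU mone c.
have mcl g : mc * g = c *: g by exact: mul_malgC.
have mcr g : g * mc = c *: g.
  apply: etrans (fgmulgU c mone g) _; rewrite [RHS]malgZ_def.
  by apply: eq_bigr => k _; rewrite mulm1 mulrC.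
by rewrite -mcl -mcl !mulrA mcr -mcl.
Qed.

Definition weyl : Type := @Quotient.quot free_alg weyl_ideal_pred.
HB.instance Definition _ := GRing.Zmodule.on weyl.

Definition weyl_pi (a : free_alg) : weyl :=
  \pi_(@Quotient.quot free_alg weyl_ideal_pred)%qT a.

Lemma weyl_piP a b : weyl_pi a = weyl_pi b <-> weyl_ideal (a - b).
Proof.
split=> [/eqP|] eq_ab.
  by apply/weyl_idealP; rewrite Quotient.idealrBE.
by apply/eqP; rewrite -Quotient.idealrBE; apply/weyl_idealP.
Qed.

Let weyl_piK (x : weyl) : weyl_pi (repr x) = x.
Proof. exact: reprK. Qed.

Let pi_ind (Q : weyl -> Prop) : (forall a, Q (weyl_pi a)) -> forall x, Q x.
Proof. by move=> Qpi x; rewrite -[x]weyl_piK. Qed.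

Lemma weyl_piD a b : weyl_pi (a + b) = weyl_pi a + weyl_pi b.
Proof. exact: pi_addr. Qed.

(* The operations on representatives; they descend to the quotient
   (weyl_piM, weyl_piZ). *)
Definition weyl_mul (x y : weyl) : weyl := weyl_pi (repr x * repr y).
Definition weyl_scale (c : K) (x : weyl) : weyl := weyl_pi (c *: repr x).

Let repr_pi a : weyl_ideal (repr (weyl_pi a) - a).
Proof. by apply/weyl_piP; rewrite weyl_piK. Qed.

Let weyl_pi_mul a b : weyl_pi (a * b) = weyl_mul (weyl_pi a) (weyl_pi b).
Proof.
apply/esym/weyl_piP; set a' := repr _; set b' := repr _.
have -> : a' * b' - a * b = (a' - a) * b' + a * (b' - b).
  by rewrite mulrBl mulrBr addrA subrK.
apply: weyl_idealD; first exact: weyl_idealMr (repr_pi _).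
exact: weyl_idealMl (repr_pi _).
Qed.

Let weyl_pi_scale c a : weyl_pi (c *: a) = weyl_scale c (weyl_pi a).
Proof.
apply/esym/weyl_piP; rewrite -scalerBr -[_ - a]mul1r scalerAl.
exact: weyl_idealMl (repr_pi _).
Qed.

Local Opaque weyl_pi weyl_mul weyl_scale.

Let weyl_mulA : associative weyl_mul.
Proof.
elim/pi_ind=> x; elim/pi_ind=> y; elim/pi_ind=> z.
rewrite -(weyl_pi_mul y z) -(weyl_pi_mul x y) -2!weyl_pi_mul.
exact: (congr1 weyl_pi (mulrA x y z)).
Qed.

Let weyl_mul1 : left_id (weyl_pi 1) weyl_mul.
Proof. by elim/pi_ind=> x; rewrite -weyl_pi_mul mul1r. Qed.

Let weyl_mulr1 : right_id (weyl_pi 1) weyl_mul.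
Proof. by elim/pi_ind=> x; rewrite -weyl_pi_mul mulr1. Qed.

Let weyl_mulDl : left_distributive weyl_mul +%R.
Proof.
elim/pi_ind=> x; elim/pi_ind=> y; elim/pi_ind=> z.
by rewrite -!(weyl_pi_mul, weyl_piD) mulrDl weyl_piD.
Qed.

Let weyl_mulDr : right_distributive weyl_mul +%R.
Proof.
elim/pi_ind=> x; elim/pi_ind=> y; elim/pi_ind=> z.
by rewrite -!(weyl_pi_mul, weyl_piD) mulrDr weyl_piD.
Qed.

Lemma weyl_pi0 : weyl_pi 0 = 0.
Proof. exact: pi_zeror. Qed.

Let weyl_oner_neq0 : weyl_pi 1 != 0.
Proof.
apply/eqP; rewrite -weyl_pi0 => /weyl_piP; rewrite subr0 => /weyl_idealP I1.
by have := weyl_ideal1; rewrite I1.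
Qed.

HB.instance Definition _ := GRing.Zmodule_isNzRing.Build weyl
  weyl_mulA weyl_mul1 weyl_mulr1 weyl_mulDl weyl_mulDr weyl_oner_neq0.

Lemma weyl_pi1 : weyl_pi 1 = 1.
Proof. by []. Qed.

Lemma weyl_piM a b : weyl_pi (a * b) = weyl_pi a * weyl_pi b.
Proof. exact: weyl_pi_mul. Qed.

Lemma weyl_piN a : weyl_pi (- a) = - weyl_pi a.
Proof. exact: pi_oppr. Qed.

Lemma weyl_pi_nat m : weyl_pi m%:R = m%:R.
Proof. by elim: m => [|m IHm]; rewrite ?weyl_pi0 // !mulrS weyl_piD IHm. Qed.

Let weyl_scaleA a b x : weyl_scale a (weyl_scale b x) = weyl_scale (a * b) x.
Proof.
elim/pi_ind: x => x; rewrite -(weyl_pi_scale b) -2!weyl_pi_scale.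
exact: (congr1 weyl_pi (scalerA a b x)).
Qed.

Let weyl_scale1 : left_id 1 weyl_scale.
Proof. by elim/pi_ind=> x; rewrite -weyl_pi_scale scale1r. Qed.

Let weyl_scaleDr : right_distributive weyl_scale +%R.
Proof.
move=> c; elim/pi_ind=> x; elim/pi_ind=> y.
by rewrite -!(weyl_pi_scale, weyl_piD) scalerDr weyl_piD.
Qed.

Let weyl_scaleDl x : {morph weyl_scale^~ x : a b / a + b}.
Proof.
by move=> a b; elim/pi_ind: x => x; rewrite -!weyl_pi_scale scalerDl weyl_piD.
Qed.

HB.instance Definition _ := GRing.Zmodule_isLmodule.Build K weyl
  weyl_scaleA weyl_scale1 weyl_scaleDr weyl_scaleDl.

Let weyl_scaleAl (c : K) (x y : weyl) : c *: (x * y) = (c *: x) * y.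
Proof.
elim/pi_ind: x => x; elim/pi_ind: y => y.
rewrite -[LHS]/(weyl_scale c (weyl_mul _ _)) -weyl_pi_mul -weyl_pi_scale.
by rewrite scalerAl weyl_pi_mul weyl_pi_scale.
Qed.

HB.instance Definition _ := GRing.Lmodule_isLalgebra.Build K weyl weyl_scaleAl.

Let weyl_scaleAr (c : K) (x y : weyl) : c *: (x * y) = x * (c *: y).
Proof.
elim/pi_ind: x => x; elim/pi_ind: y => y.
rewrite -[LHS]/(weyl_scale c (weyl_mul _ _)) -weyl_pi_mul -weyl_pi_scale.
by rewrite free_scaleAr weyl_pi_mul weyl_pi_scale.
Qed.

HB.instance Definition _ := GRing.Lalgebra_isAlgebra.Build K weyl weyl_scaleAr.

Lemma weyl_piZ c a : weyl_pi (c *: a) = c *: weyl_pi a.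
Proof. exact: weyl_pi_scale. Qed.

Definition weyl_gen (i : 'I_(n + n)) : weyl := weyl_pi (free_gen i).

Lemma weyl_ideal_relator r : weyl_relator r -> weyl_ideal r.
Proof. by move=> rel; rewrite -[r]mul1r -[1 * r]mulr1; constructor. Qed.

Local Notation hx i := (weyl_gen (lshift n i)).
Local Notation hp i := (weyl_gen (rshift n i)).

Lemma weyl_xx i j : hx i * hx j = hx j * hx i.
Proof.
by rewrite -!weyl_piM; apply/weyl_piP/weyl_ideal_relator; apply: weyl_relator_xx.
Qed.

Lemma weyl_pp i j : hp i * hp j = hp j * hp i.
Proof.
by rewrite -!weyl_piM; apply/weyl_piP/weyl_ideal_relator; apply: weyl_relator_pp.
Qed.

Lemma weyl_px i j : hp i * hx j - hx j * hp i = (i == j)%:R.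
Proof.
rewrite -!weyl_piM -weyl_piN -weyl_piD -weyl_pi_nat; apply/weyl_piP.
exact/weyl_ideal_relator/weyl_relator_px.
Qed.

End WeylAlgebra.

Notation poisson_alg K n := (mpoly (n + n) K).

Section PoissonAlgebra.
Variables (K : fieldType) (n : nat).

Definition poisson_gen (i : 'I_(n + n)) : poisson_alg K n := mpolyX K (mnm1 i).

Definition poisson_bracket (f g : poisson_alg K n) : poisson_alg K n :=
  \sum_(i < n) (mderiv (rshift n i) f * mderiv (lshift n i) g
                - mderiv (lshift n i) f * mderiv (rshift n i) g).

End PoissonAlgebra.

Definition alg_aut (K : fieldType) (A : algType K) (phi : A -> A) : Prop :=
  (exists f : {lrmorphism A -> A}, f =1 phi) /\ bijective phi.

Definition symplectomorphism (K : fieldType) (n : nat)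
    (phi : poisson_alg K n -> poisson_alg K n) : Prop :=
  alg_aut phi /\
  {morph phi : f g / poisson_bracket f g}.

Definition origin_preserving (K : fieldType) (n : nat)
    (phi : poisson_alg K n -> poisson_alg K n) : Prop :=
  forall i, mpoly.mcoeff mnm0 (phi (poisson_gen K i)) = 0.

Inductive generated_group (A : Type) (S : set (A -> A)) : set (A -> A) :=
| generated_mem f : S f -> generated_group S f
| generated_id : generated_group S id
| generated_comp f g :
    generated_group S f -> generated_group S g -> generated_group S (f \o g)
| generated_inv f g :
    generated_group S f -> cancel f g -> cancel g f -> generated_group S g.

Section TameAutomorphisms.
Variables (K : fieldType) (n : nat).

(* A formula lists the images of the 2n generators as polynomials. It is read
   in an algebra A with distinguished elements z_i by substituting z_i for the
   i-th variable; in each monomial the factors are multiplied in increasing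
   order of the indices. In W_n this is the normal ordering (x's left of p's),
   for which every element of the subalgebra generated by some of the z_i is
   the value of a polynomial in the corresponding variables. *)
Definition formula : Type := 'I_(n + n) -> poisson_alg K n.

Definition given_by (A : algType K) (z : 'I_(n + n) -> A) (F : formula)
    (phi : A -> A) : Prop :=
  forall i, phi (z i) = mpoly.mmap (GRing.in_alg A) z (F i).

Definition symplectic_form : 'M[K]_(n + n) := block_mx 0 1%:M (- 1%:M) 0.

(* With images of generators as rows of M, z_i |-> sum_j M i j z_j, the bracket
   is preserved iff M J M^T = J; this set of matrices is closed under
   transposition, so it is the usual Sp(2n). *)
Definition symplectic (M : 'M[K]_(n + n)) : Prop :=
  M *m symplectic_form *m M^T = symplectic_form.

Definition linear_formula (M : 'M[K]_(n + n)) : formula :=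
  fun i => \sum_j M i j *: poisson_gen K j.

Definition elementary_formula (k : 'I_(n + n)) (a : K) (f : poisson_alg K n) :
    formula :=
  fun i => if i == k then a *: poisson_gen K k + f else poisson_gen K i.

Variant tame_formula : formula -> Prop :=
| tame_linear M : symplectic M -> tame_formula (linear_formula M)
| tame_elementary k a (f : poisson_alg K n) :
    a != 0 ->
    (forall m : multinom (n + n), m \in mpoly.msupp f -> m k = 0%N) ->
    mpoly.mcoeff mnm0 f = 0 ->
    tame_formula (elementary_formula k a f).

Definition TAutP : set (poisson_alg K n -> poisson_alg K n) :=
  generated_group [set phi | symplectomorphism phi /\
    exists2 F, tame_formula F & given_by (@poisson_gen K n) F phi].

Definition TAutW : set (weyl K n -> weyl K n) :=
  generated_group [set psi | alg_aut psi /\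
    exists2 F, tame_formula F & given_by (@weyl_gen K n) F psi].

(* Phi restricts to the group isomorphism TAut W_n -> TAut P_n which maps each
   generating automorphism to the one given by the same formula; the values of
   Phi outside TAutW are irrelevant. *)
Record tame_isomorphism
    (Phi : (weyl K n -> weyl K n) -> (poisson_alg K n -> poisson_alg K n)) :
    Prop := {
  tame_isomorphism_bij : set_bij TAutW TAutP Phi;
  tame_isomorphism_comp : forall psi1 psi2, TAutW psi1 -> TAutW psi2 ->
    Phi (psi1 \o psi2) = Phi psi1 \o Phi psi2;
  tame_isomorphism_formula : forall F psi, tame_formula F -> alg_aut psi ->
    given_by (@weyl_gen K n) F psi -> given_by (@poisson_gen K n) F (Phi psi)
}.

End TameAutomorphisms.

Section PowerSeriesTopology.
Variables (R : realType) (K : fieldType).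

(* The infimum is a minimum when f != 0, and +oo when f = 0. *)
Definition height (N : nat) (f : mpoly N K) : \bar R :=
  ereal_inf [set (k%:R)%:E | k in [set k : nat | pihomog mdeg k f != 0]].

Definition tuple_height (N M : nat) (F : 'I_M -> mpoly N K) : \bar R :=
  \big[Order.min/+oo%E]_(i < M) height (F i).

Definition end_dist (n : nat) (phi psi : poisson_alg K n -> poisson_alg K n) :
    R :=
  let diff i := phi (poisson_gen K i) - psi (poisson_gen K i) in
  fine (expeR (- tuple_height diff)).

End PowerSeriesTopology.

(* Main.v *)
(* Since [Phi] maps TAut W_n onto TAut P_n, it suffices to approximate [sigma]
   by tame automorphisms of P_n. The linear part of [sigma] is symplectic, hence
   tame. If a symplectomorphism [rho] is the identity up to terms of degree
   N >= 2, then its component of degree N is a closed one-form, hence of the form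
   {h, z_i} with h homogeneous of degree N + 1. In characteristic 0, h is a
   linear combination of powers u^(N+1) of linear forms, and the time-c flow of
   u^(N+1) is the shear z_i |-> z_i + c (N+1) {u, z_i} u^N. It is elementary for
   u = x_1, and conjugate to that one by a symplectic transvection as soon as
   {u, x_1} != 0. Composing shears removes the terms of degree N. *)
From HB Require Import structures.
Require Import Defs.
From mathcomp Require Import all_boot all_order all_algebra.
From mathcomp Require Import -(notations) mpoly.
From mathcomp Require Import ring.
From mathcomp Require Import complex.
From mathcomp Require Import all_classical all_reals all_analysis.

Set Implicit Arguments.
Unset Strict Implicit.
Unset Printing Implicit Defensive.

Import Order.TTheory GRing.Theory Num.Theory.
Import numFieldNormedType.Exports.
Local Open Scope classical_set_scope.
Local Open Scope ring_scope.
Local Open Scope complex_scope.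

Local Notation "''Y_' i" := (@mpolyX _ _ (mnm1 i)) (at level 8, i at level 2).
Local Notation homog d := (ishomog1 d (@mdeg _)).

(** * Orders of vanishing at the origin, and homogeneous polynomials *)

Section Order.
Context (d : nat) (K : fieldType).
Local Notation P := (mpoly d K).
Implicit Types (p q : P) (m : multinom d).

Lemma mnm_ind (Q : multinom d -> Prop) :
  Q mnm0 -> (forall i m, Q m -> Q (mnm_add (mnm1 i) m)) -> forall m, Q m.
Proof.
move=> Q0 QS m; move: {2}(mdeg m) (erefl (mdeg m)) => k.
elim: k m => [m /eqP|k IHk m mE]; first by rewrite mdeg_eq0 => /eqP ->.
have [i mi] : exists i, m i != 0%N.
  apply/existsP; apply: contraPT (mE); rewrite negb_exists => /forallP m0.
  by rewrite mdegE big1 // => i _; have := m0 i; rewrite negbK => /eqP.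
have lem : mpoly.lem (mnm1 i) m by rewrite lep1mP.
rewrite -(submK lem) addmC; apply/QS/IHk.
by apply/eqP; rewrite -eqSS -mE -{2}(submK lem) mdegD mdeg1 addn1.
Qed.

Lemma mpoly_alg_ind (Q : P -> Prop) :
  Q 1 -> (forall i p, Q p -> Q ('Y_i * p)) ->
  (forall p q, Q p -> Q q -> Q (p + q)) -> (forall c p, Q p -> Q (c *: p)) ->
  forall p, Q p.
Proof.
move=> Q1 QX QD QZ p; rewrite (mpolyE p).
elim/big_ind: _ => // [|m _]; first by rewrite -(scale0r 1); apply: QZ.
apply: QZ; elim/mnm_ind: m => [|i m IHm]; first by rewrite mpolyX0.
by rewrite mpolyXD; apply: QX.
Qed.

(* [mideal k] is the k-th power of the ideal of the origin, that is, height >= k. *)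
Definition mideal_pred (k : nat) : {pred P} :=
  fun p => all (fun m => k <= mdeg m)%N (msupp p).
Definition mideal (k : nat) := [qualify a p | mideal_pred k p].

Lemma midealP k p :
  reflect (forall m, (mdeg m < k)%N -> mcoeff m p = 0) (p \is a mideal k).
Proof.
apply: (iffP allP) => [hp m hm|hp m].
  by apply: memN_msupp_eq0; apply/negP => /hp; rewrite leqNgt hm.
by rewrite mcoeff_msupp leqNgt; apply: contraNN => /hp ->.
Qed.

Lemma mideal_submod_closed k : submod_closed (mideal k).
Proof.
split=> [|c p q /midealP hp /midealP hq]; apply/midealP => m hm.
  by rewrite mcoeff0.
by rewrite mcoeffD mcoeffZ hp ?hq // mulr0 addr0.
Qed.

HB.instance Definition _ k :=
  GRing.isSubmodClosed.Build K P (mideal_pred k) (mideal_submod_closed k).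

Lemma midealX k m : (mpolyX K m \is a mideal k) = (k <= mdeg m)%N.
Proof. by rewrite /mideal unfold_in /= /mideal_pred msuppX /= andbT. Qed.

Lemma mideal_gen i : 'Y_i \is a mideal 1.
Proof. by rewrite midealX mdeg1. Qed.

Lemma mideal0 p : p \is a mideal 0.
Proof. exact/midealP. Qed.

Lemma midealW j k p : (j <= k)%N -> p \is a mideal k -> p \is a mideal j.
Proof.
by move=> jk /midealP hp; apply/midealP => m hm; apply/hp/(leq_trans hm).
Qed.

Lemma midealM j k p q :
  p \is a mideal j -> q \is a mideal k -> p * q \is a mideal (j + k).
Proof.
move=> hp hq; rewrite (mpolyE p) (mpolyE q) mulr_suml big_seq.
apply: rpred_sum => m1 /(allP hp) h1; rewrite mulr_sumr big_seq.
apply: rpred_sum => m2 /(allP hq) h2.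
rewrite -scalerAl -scalerAr -mpolyXD; do 2!apply: rpredZ.
by rewrite midealX mdegD leq_add.
Qed.

Lemma mideal_exp j k p : p \is a mideal j -> p ^+ k \is a mideal (j * k).
Proof.
move=> hp; elim: k => [|k IHk]; first by rewrite muln0 mideal0.
by rewrite exprS mulnS midealM.
Qed.

Lemma mideal_mderiv k i p : p \is a mideal k -> mderiv i p \is a mideal k.-1.
Proof.
move/midealP => hp; apply/midealP => m hm.
rewrite mcoeff_deriv hp ?mul0rn // mdegD mdeg1 addn1.
by case: k hm {hp} => // k; rewrite ltnS.
Qed.

Lemma mideal_homog k p : p \is homog k -> p \is a mideal k.
Proof. by move/dhomogP=> hp; apply/allP => m /hp /= ->. Qed.

Lemma mideal_homog_eq0 k p : p \is homog k -> p \is a mideal k.+1 -> p = 0.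
Proof.
move=> hp /midealP h; apply/mpolyP => m; rewrite mcoeff0.
have [/eqP mk|/dhomog_nemf_coeff -> //] := boolP (mdeg m == k).
by rewrite h ?mk.
Qed.

Lemma mcoeff_pihomog k p m :
  mcoeff m (pihomog (@mdeg d) k p) = if mdeg m == k then mcoeff m p else 0.
Proof.
rewrite (mpolyE p) (raddf_sum (pihomog (@mdeg d) k)) !(raddf_sum (mcoeff m)) /=.
rewrite [RHS](_ : _ = \sum_(m' <- msupp p)
  if mdeg m == k then mcoeff m (mcoeff m' p *: mpolyX K m') else 0); last first.
  by case: ifP => // _; rewrite big1.
apply: eq_bigr => m' _.
rewrite (linearZ_LR (pihomog (@mdeg d) k)) !mcoeffZ /= pihomogX.
have [<-|ne] := eqVneq m' m; first by case: ifP; rewrite ?mcoeff0 ?mulr0.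
by case: ifP; case: ifP; rewrite ?mcoeffX ?mcoeff0 ?(negbTE ne) ?mulr0.
Qed.

Lemma pihomog_mideal k p : p \is a mideal k ->
  p - pihomog (@mdeg d) k p \is a mideal k.+1.
Proof.
move/midealP => hp; apply/midealP => m; rewrite ltnS => hm.
rewrite mcoeffB mcoeff_pihomog; case: eqP => [_|/eqP mk]; first by rewrite subrr.
by rewrite hp ?subr0 // ltn_neqAle mk.
Qed.

Lemma mderiv_homog k i p : p \is homog k -> mderiv i p \is homog k.-1.
Proof.
move=> hp; apply/dhomogP => m; rewrite mcoeff_msupp mcoeff_deriv => nz /=.
have /(dhomogP _ _ _ hp) /= <- : mnm_add m (mnm1 i) \in msupp p.
  by rewrite mcoeff_msupp; apply: contraNN nz => /eqP ->; rewrite mul0rn.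
by rewrite mdegD mdeg1 addn1.
Qed.

Lemma homog1_expand p : p \is homog 1 -> p = \sum_i mcoeff (mnm1 i) p *: 'Y_i.
Proof.
move=> hp; apply/mpolyP => m; rewrite (raddf_sum (mcoeff m)) /=.
have [/mdeg1P [i /eqP ->]|m1] := boolP (mdeg m == 1%N).
  rewrite (bigD1 i) //= mcoeffZ mcoeffX eqxx mulr1 big1 ?addr0 // => j ji.
  by rewrite mcoeffZ mcoeffX eq_mnm1 (negbTE ji) mulr0.
rewrite (dhomog_nemf_coeff hp) // big1 // => i _.
rewrite mcoeffZ mcoeffX; case: eqP => [e|_]; last by rewrite mulr0.
by rewrite -e mdeg1 eqxx in m1.
Qed.

Lemma homog0_const p : p \is homog 0 -> p = (mcoeff mnm0 p)%:A.
Proof.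
move=> hp; apply/mpolyP => m; rewrite mcoeffZ mcoeff1.
have [->|m0] := eqVneq m mnm0; first by rewrite mulr1.
by rewrite (dhomog_nemf_coeff hp) ?mulr0 //= mdeg_eq0.
Qed.

Lemma homog_gen i : ('Y_i : P) \is homog 1.
Proof. by rewrite dhomogX /= mdeg1. Qed.

Lemma euler_identity k p : p \is homog k -> \sum_i 'Y_i * mderiv i p = k%:R *: p.
Proof.
move=> hp; rewrite {1}(mpolyE p) [in RHS](mpolyE p) scaler_sumr.
under eq_bigr do rewrite raddf_sum /= mulr_sumr.
rewrite exchange_big big_seq [RHS]big_seq; apply: eq_bigr => m mp /=.
have <- : mdeg m = k by exact: (dhomogP _ _ _ hp).
rewrite mdegE natr_sum scaler_suml; apply: eq_bigr => i _.
rewrite mderivZ mderivX -!scalerAr !scalerA mulrC -mpolyXD.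
(* The case [m i = 0] is set apart because the subtraction of exponents truncates there; the
   coefficient [m i] kills the term. *)
have [->|mi] := eqVneq (m i) 0%N; first by rewrite mul0r !scale0r.
by rewrite addmC submK // lep1mP.
Qed.

End Order.
Arguments mideal {d K} k.

(** * Substitution endomorphisms and automorphisms of polynomial algebras *)

Section Endomorphisms.
Context (d : nat) (K : fieldType).
Local Notation P := (mpoly d K).
Implicit Types (f g : {lrmorphism P -> P}) (p q : P).

Definition endo (F : 'I_d -> P) : P -> P := mmap (GRing.in_alg P) F.
HB.instance Definition _ F := GRing.RMorphism.on (endo F).

Fact endo_is_scalable F : scalable (endo F).
Proof. by move=> c p; rewrite /endo mmapZ mulr_algl. Qed.
HB.instance Definition _ F := GRing.isScalable.Build K P P *:%R (endo F)
  (endo_is_scalable F).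

Lemma endo_gen F i : endo F 'Y_i = F i.
Proof. by rewrite /endo mmapX mmap1U. Qed.

Lemma lrmorphism_ext f g : (forall i, f 'Y_i = g 'Y_i) -> f =1 g.
Proof.
move=> fg; elim/mpoly_alg_ind => [|i p IHp|p q IHp IHq|c p IHp].
- by rewrite !rmorph1.
- by rewrite !rmorphM /= fg IHp.
- by rewrite !rmorphD /= IHp IHq.
- by rewrite !linearZ /= IHp.
Qed.

Lemma endo_id p : endo (fun i => 'Y_i) p = p.
Proof.
by apply: (lrmorphism_ext (f := endo _) (g := idfun)) => i /=; rewrite endo_gen.
Qed.

Lemma lrmorphism_mideal f k p :
  (forall i, f 'Y_i \is a mideal 1) -> p \is a mideal k -> f p \is a mideal k.
Proof.
move=> f1 /allP hp; rewrite (mpolyE p) raddf_sum /= big_seq.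
apply: rpred_sum => m /hp /midealW; apply => {hp}.
rewrite linearZ /=; apply: rpredZ.
elim/mnm_ind: m => [|i m IHm]; first by rewrite mdeg0 mideal0.
by rewrite mpolyXD rmorphM /= mdegD mdeg1; apply: midealM.
Qed.

(** The displacement of a product is a sum over its factors: moving one generator raises the order
    by [k], and the other factors keep theirs. *)
Lemma lrmorphism_near_id f k l p :
  (forall i, f 'Y_i - 'Y_i \is a mideal k.+1) -> p \is a mideal l ->
  f p - p \is a mideal (l + k).
Proof.
move=> fk /allP hp; rewrite {2}(mpolyE p) {1}(mpolyE p) raddf_sum /= -sumrB big_seq.
apply: rpred_sum => m /hp hm; apply: (midealW (k := mdeg m + k)).
  by rewrite leq_add2r.
rewrite linearZ /= -scalerBr; apply: rpredZ => {hp hm}.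
have f1 i : f 'Y_i \is a mideal 1.
  by rewrite -(subrK 'Y_i (f _)) rpredD ?mideal_gen // (midealW (k := k.+1)).
elim/mnm_ind: m => [|i m IHm]; first by rewrite mpolyX0 rmorph1 subrr rpred0.
rewrite mpolyXD rmorphM /= mdegD mdeg1.
have -> : f 'Y_i * f (mpolyX K m) - 'Y_i * mpolyX K m =
  f 'Y_i * (f (mpolyX K m) - mpolyX K m) + (f 'Y_i - 'Y_i) * mpolyX K m by ring.
apply: rpredD; first by rewrite -addnA midealM.
by rewrite addnAC add1n midealM // midealX.
Qed.

Lemma alg_aut_comp (phi psi : P -> P) :
  alg_aut phi -> alg_aut psi -> alg_aut (phi \o psi).
Proof.
move=> [[f ff] bf] [[g gg] bg]; split; last exact: bij_comp.
by exists (f \o g) => x /=; rewrite gg ff.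
Qed.

Lemma alg_aut_id : alg_aut (@id P).
Proof. by split; [exists idfun | exists id]. Qed.

Lemma alg_aut_inv (phi psi : P -> P) :
  alg_aut phi -> cancel phi psi -> cancel psi phi -> alg_aut psi.
Proof.
move=> [[f ff] _] pK qK; split; last by exists phi.
have pf x : phi x = f x by rewrite ff.
have inj x y : phi x = phi y -> x = y by move=> /(congr1 psi); rewrite !pK.
have a : GRing.additive psi.
  by move=> x y; apply: inj; rewrite qK !pf rmorphB /= -!pf !qK.
have m : GRing.multiplicative psi.
  split=> [x y|]; apply: inj; first by rewrite qK !pf rmorphM /= -!pf !qK.
  by rewrite qK pf rmorph1.
have s : scalable psi.
  by move=> c x; apply: inj; rewrite qK !pf linearZ /= -!pf !qK.
pose A := GRing.isAdditive.Build _ _ _ a.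
pose M := GRing.isMultiplicative.Build _ _ _ m.
pose S := GRing.isScalable.Build _ _ _ _ _ s.
pose g : {lrmorphism P -> P} := HB.pack psi A M S.
by exists g.
Qed.

End Endomorphisms.

(** * Bilinearity and Leibniz rules of the Poisson bracket *)

Section Bracket.
Context (K : fieldType) (n : nat).
Local Notation P := (poisson_alg K n).
Local Notation z := (@poisson_gen K n).
Local Notation pb := (@poisson_bracket K n).
Implicit Types (p q r : P).

Lemma bracket_antisym p q : pb p q = - pb q p.
Proof.
rewrite /poisson_bracket -sumrN; apply: eq_bigr => i _.
by ring.
Qed.

Fact bracket_is_linear p : linear (pb p).
Proof.
move=> c q r; rewrite /poisson_bracket scaler_sumr -big_split /=.
apply: eq_bigr => i _; rewrite !mderivD !mderivZ !mulrDr -!scalerAr scalerBr.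
by rewrite opprD addrACA.
Qed.
HB.instance Definition _ p := GRing.isLinear.Build K P P *:%R (pb p)
  (bracket_is_linear p).

Lemma bracketDl p q r : pb (p + q) r = pb p r + pb q r.
Proof. by rewrite bracket_antisym raddfD /= opprD -!bracket_antisym. Qed.

Lemma bracketNl p q : pb (- p) q = - pb p q.
Proof. by rewrite bracket_antisym raddfN /= (bracket_antisym p). Qed.

Lemma bracketZl c p q : pb (c *: p) q = c *: pb p q.
Proof. by rewrite bracket_antisym linearZ /= (bracket_antisym p) scalerN. Qed.

Lemma bracketMr p q r : pb p (q * r) = pb p q * r + q * pb p r.
Proof.
rewrite /poisson_bracket mulr_suml mulr_sumr -big_split /=.
by apply: eq_bigr => i _; rewrite !mderivM; ring.
Qed.

Lemma bracket1r p : pb p 1 = 0.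
Proof.
by apply: (addIr (pb p 1)); rewrite add0r -{1}[pb p 1]mulr1 -{2}[pb p 1]mul1r
  -bracketMr mulr1.
Qed.

Lemma bracketMl p q r : pb (p * q) r = pb p r * q + p * pb q r.
Proof.
rewrite bracket_antisym bracketMr opprD -mulNr -mulrN.
by rewrite -!(bracket_antisym _ r) addrC mulrC.
Qed.

End Bracket.

(** * Symplectomorphisms and linear symplectic substitutions *)

Section Symplectic.
Context (K : fieldType) (n : nat).
Local Notation P := (poisson_alg K n).
Local Notation z := (@poisson_gen K n).
Local Notation pb := (@poisson_bracket K n).
Implicit Types (p q r : P) (phi psi : P -> P).

(** With [conj_sgn], this gives a uniform encoding of the bracket: {z_k, .} is a signed derivative
    in the conjugate variable, whether z_k is an x or a p. *)
Definition conj_idx (k : 'I_(n + n)) : 'I_(n + n) :=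
  match fintype.split k with inl j => rshift n j | inr j => lshift n j end.

Definition conj_sgn (k : 'I_(n + n)) : K :=
  match fintype.split k with inl _ => -1 | inr _ => 1 end.

Lemma split_lshift (j : 'I_n) : fintype.split (lshift n j) = inl j.
Proof. exact: (unsplitK (inl j)). Qed.

Lemma split_rshift (j : 'I_n) : fintype.split (rshift n j) = inr j.
Proof. exact: (unsplitK (inr j)). Qed.

Lemma conj_idxK : involutive conj_idx.
Proof.
by move=> k; rewrite /conj_idx; case: (split_ordP k) => j ->;
  rewrite ?(split_lshift, split_rshift).
Qed.

Lemma conj_sgn_conj k : conj_sgn (conj_idx k) = - conj_sgn k.
Proof.
by rewrite /conj_idx /conj_sgn; case: (split_ordP k) => j _;
  rewrite ?(split_lshift, split_rshift) ?opprK.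
Qed.

Lemma conj_sgn_sqr k : conj_sgn k * conj_sgn k = 1.
Proof. by rewrite /conj_sgn; case: fintype.split => _; rewrite ?mulrNN mulr1. Qed.

Lemma mderiv_gen i j : mderiv i (z j) = (i == j)%:R.
Proof.
rewrite mderivX mnm1E eq_sym; case: eqVneq => [->|_]; last by rewrite scale0r.
suff -> : mnm_sub (mnm1 j) (mnm1 j) = mnm0 :> multinom (n + n).
  by rewrite mpolyX0 scale1r.
by apply/mnmP => k; rewrite mnmBE mnm0E subnn.
Qed.

Lemma bracket_genl k q : pb (z k) q = conj_sgn k *: mderiv (conj_idx k) q.
Proof.
rewrite /poisson_bracket /conj_sgn /conj_idx; case: (split_ordP k) => j ->.
  rewrite (bigD1 j) //= big1 ?addr0 => [|i ij]; rewrite !mderiv_gen.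
    by rewrite eq_rlshift eqxx mul0r mul1r sub0r scaleN1r.
  by rewrite eq_rlshift eq_lshift (negbTE ij) !mul0r subrr.
rewrite (bigD1 j) //= big1 ?addr0 => [|i ij]; rewrite !mderiv_gen.
  by rewrite eq_lrshift eqxx mul0r mul1r subr0 scale1r.
by rewrite eq_lrshift eq_rshift (negbTE ij) !mul0r subrr.
Qed.

Lemma bracket_genr q k : pb q (z k) = - conj_sgn k *: mderiv (conj_idx k) q.
Proof. by rewrite bracket_antisym bracket_genl scaleNr. Qed.

(** The minus sign reconciles {p_i, x_i} = 1 with the identity in the upper right block of
    [symplectic_form], which pairs x_i with p_i. *)
Lemma bracket_gen i j : pb (z i) (z j) = (- symplectic_form K n i j)%:A.
Proof.
rewrite bracket_genl mderiv_gen /conj_sgn /conj_idx /symplectic_form.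
case: (split_ordP i) => i' ->; case: (split_ordP j) => j' ->;
  rewrite ?(split_lshift, split_rshift).
- by rewrite block_mxEul mxE eq_rlshift scaler0 oppr0 scale0r.
- rewrite block_mxEur mxE eq_rshift; case: eqVneq => _.
    by rewrite mulr1n.
  by rewrite scaler0 mulr0n oppr0 scale0r.
- rewrite block_mxEdl !mxE eq_lshift opprK; case: eqVneq => _.
    by rewrite mulr1n.
  by rewrite scaler0 mulr0n scale0r.
- by rewrite block_mxEdr mxE eq_lrshift scaler0 oppr0 scale0r.
Qed.

Lemma bracket_linear_formula (M N : 'M[K]_(n + n)) i j :
  pb (linear_formula M i) (linear_formula N j) =
  (- (M *m symplectic_form K n *m N^T) i j)%:A.
Proof.
rewrite /linear_formula raddf_sum /= mxE -sumrN scaler_suml.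
apply: eq_bigr => l _; rewrite linearZ /=.
have -> : pb (\sum_k M i k *: z k) (z l) = \sum_k M i k *: pb (z k) (z l).
  rewrite bracket_antisym (raddf_sum (pb (z l))) /= -sumrN; apply: eq_bigr => k _.
  by rewrite linearZ /= -scalerN -bracket_antisym.
rewrite [N^T _ _]mxE mxE mulr_suml -sumrN scaler_suml scaler_sumr.
apply: eq_bigr => k _; rewrite bracket_gen !scalerA.
by congr (_ *: 1); ring.
Qed.

Lemma bracket_mideal j k p q : p \is a mideal j -> q \is a mideal k ->
  pb p q \is a mideal (j.-1 + k.-1).
Proof.
move=> hp hq; apply: rpred_sum => i _.
by apply: rpredB; apply: midealM; apply: mideal_mderiv.
Qed.

Lemma bracket_homog1 p q : p \is homog 1 -> q \is homog 1 ->
  pb p q = (mcoeff mnm0 (pb p q))%:A.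
Proof.
move=> hp hq; apply: homog0_const; apply: rpred_sum => i _.
have h0 (r : P) : r \is homog 1 -> forall j, mderiv j r \is homog 0.
  by move=> hr j; exact: (mderiv_homog j hr).
by apply: rpredB; apply: (dhomogM (d := 0) (e := 0)); apply: h0.
Qed.

(** Both f({p, q}) and {f(p), f(q)} are derivations along [f] in each argument, so comparing them on
    generators is enough. The second argument is extended first, then the first. *)
Lemma lrmorphism_symplectic (f : {lrmorphism P -> P}) :
  (forall i j, pb (f (z i)) (f (z j)) = pb (z i) (z j)) ->
  {morph f : p q / pb p q}.
Proof.
move=> fz.
have fzq i q : f (pb (z i) q) = pb (f (z i)) (f q).
  elim/mpoly_alg_ind: q => [|j q IHq|q r IHq IHr|c q IHq].
  - by rewrite rmorph1 !bracket1r raddf0.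
  - rewrite -/(z j) rmorphM /= !bracketMr rmorphD !rmorphM /= IHq.
    by rewrite fz bracket_gen rmorph_alg.
  - by rewrite !raddfD /= IHq IHr.
  - by rewrite !linearZ /= IHq.
elim/mpoly_alg_ind => [|j p IHp|p r IHp IHr|c p IHp] q.
- by rewrite rmorph1 !(bracket_antisym 1) !bracket1r oppr0 raddf0.
- by rewrite -/(z j) rmorphM /= !bracketMl rmorphD !rmorphM /= IHp fzq.
- by rewrite raddfD /= !bracketDl raddfD /= IHp IHr.
- by rewrite linearZ /= !bracketZl linearZ /= IHp.
Qed.

Lemma symplectomorphism_comp phi psi :
  symplectomorphism phi -> symplectomorphism psi ->
  symplectomorphism (phi \o psi).
Proof.
move=> [aphi sphi] [apsi spsi]; split; first exact: alg_aut_comp.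
by move=> p q /=; rewrite spsi sphi.
Qed.

Lemma symplectomorphism_id : symplectomorphism (@id P).
Proof. by split=> //; apply: alg_aut_id. Qed.

Lemma symplectomorphism_inv phi psi : symplectomorphism phi ->
  cancel phi psi -> cancel psi phi -> symplectomorphism psi.
Proof.
move=> [aphi sphi] pK qK; split; first exact: alg_aut_inv aphi pK qK.
by move=> p q; rewrite -{1}[p]qK -{1}[q]qK -sphi pK.
Qed.

Lemma origin_preservingP phi :
  origin_preserving phi <-> forall i, phi (z i) \is a mideal 1.
Proof.
split=> h i; last by have /midealP -> := h i; rewrite ?mdeg0.
by apply/midealP => m; rewrite ltnS leqn0 mdeg_eq0 => /eqP ->.
Qed.

Lemma origin_preserving_comp phi psi : alg_aut phi ->
  origin_preserving phi -> origin_preserving psi ->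
  origin_preserving (phi \o psi).
Proof.
move=> [[f fE] _] /origin_preservingP ophi /origin_preservingP opsi.
apply/origin_preservingP => i /=; rewrite -fE; apply: lrmorphism_mideal => // j.
by rewrite fE; apply: ophi.
Qed.

(** If c is the constant term of psi(z_i), then [phi] maps psi(z_i) - c to z_i - c. As [phi]
    preserves the ideal of the origin, c = 0. *)
Lemma origin_preserving_inv phi psi : alg_aut phi ->
  cancel psi phi -> origin_preserving phi -> origin_preserving psi.
Proof.
move=> [[f fE] _] qK /origin_preservingP ophi i.
set c := mcoeff _ _.
have : f (psi (z i) - c%:A) \is a mideal 1.
  apply: lrmorphism_mideal => [j|]; first by rewrite fE; apply: ophi.
  apply/midealP => m; rewrite ltnS leqn0 mdeg_eq0 => /eqP ->.
  by rewrite mcoeffB mcoeffZ mcoeff1 eqxx mulr1 subrr.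
rewrite raddfB /= rmorph_alg fE qK => /midealP /(_ mnm0).
rewrite mdeg0 mcoeffB mcoeffZ mcoeff1 eqxx mulr1 mcoeffX mnm1_eq0 sub0r.
by move=> /(_ isT) /eqP; rewrite oppr_eq0 => /eqP.
Qed.

(** Substituting the generators of a polynomial algebra into a polynomial returns that
    polynomial. *)
Lemma given_by_poisson (F : formula K n) phi :
  given_by z F phi <-> forall i, phi (z i) = F i.
Proof.
have E i : mpoly.mmap (GRing.in_alg P) z (F i) = F i by exact: endo_id.
by split=> h i; have := h i; rewrite E.
Qed.

Lemma TAutP_symplectic phi :
  TAutP phi -> symplectomorphism phi /\ origin_preserving phi.
Proof.
elim=> [f [sf [F tF /given_by_poisson fF]]||f g _ [sf of_] _ [sg og]
       |f g _ [sf of_] fK gK].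
- split=> // i; rewrite fF; case: tF => [M _|k a q _ _ q0].
    rewrite /linear_formula (raddf_sum (mcoeff _)) big1 //= => j _.
    by rewrite mcoeffZ mcoeffX mnm1_eq0 mulr0.
  rewrite /elementary_formula; case: eqP => _; last by rewrite mcoeffX mnm1_eq0.
  by rewrite mcoeffD mcoeffZ mcoeffX mnm1_eq0 mulr0 add0r.
- split; first exact: symplectomorphism_id.
  by move=> i; rewrite mcoeffX mnm1_eq0.
- split; first exact: symplectomorphism_comp.
  by apply: origin_preserving_comp => //; case: sf.
- split; first exact: symplectomorphism_inv sf fK gK.
  by apply: origin_preserving_inv gK of_; case: sf.
Qed.

Lemma bracket_self p : pb p p = 0.
Proof. by rewrite /poisson_bracket big1 // => i _; rewrite mulrC subrr. Qed.

Lemma bracket_exp p q k : pb p (q ^+ k.+1) = k.+1%:R *: (pb p q * q ^+ k).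
Proof.
elim: k => [|k IHk]; first by rewrite expr1 expr0 mulr1 scale1r.
rewrite exprS bracketMr IHk -scalerAr mulrCA -exprS.
by rewrite -(natr1 k.+1) scalerDl scale1r addrC.
Qed.

Lemma mul_symplectic_form :
  symplectic_form K n *m symplectic_form K n = - 1%:M.
Proof.
rewrite /symplectic_form mulmx_block !mulmx0 !mul0mx !mul1mx !mulmx1.
by rewrite !addr0 !add0r [in RHS]scalar_mx_block opp_block_mx !oppr0.
Qed.

Lemma symplectic_inv (M : 'M[K]_(n + n)) :
  symplectic M -> exists2 N, M *m N = 1%:M & N *m M = 1%:M.
Proof.
(* With J the symplectic form, multiplying M J M^T = J on the right by -J gives the inverse, because
   J^2 = -1. *)
move=> sM; pose N := symplectic_form K n *m M^T *m (- symplectic_form K n).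
have MN : M *m N = 1%:M.
  by rewrite /N !mulmxA sM mulmxN mul_symplectic_form opprK.
by exists N => //; apply: mulmx1C.
Qed.

Lemma linear_formula1 i : linear_formula 1%:M i = z i.
Proof.
rewrite /linear_formula (bigD1 i) //= mxE eqxx scale1r big1 ?addr0 // => j ji.
by rewrite mxE eq_sym (negbTE ji) scale0r.
Qed.

Lemma endo_linear_formula (M N : 'M[K]_(n + n)) i :
  endo (linear_formula M) (linear_formula N i) = linear_formula (N *m M) i.
Proof.
rewrite {2}/linear_formula raddf_sum /=.
under eq_bigr => j _ do rewrite linearZ /= endo_gen scaler_sumr.
rewrite exchange_big; apply: eq_bigr => k _ /=.
rewrite mxE scaler_suml; apply: eq_bigr => j _; exact: scalerA.
Qed.

(** The coefficients of the [F i] form a matrix, and preserving the brackets of generators makes it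
    symplectic. Its inverse matrix supplies the inverse automorphism. *)
Lemma TAutP_linear (F : formula K n) : (forall i, F i \is homog 1) ->
  (forall i j, pb (F i) (F j) = pb (z i) (z j)) -> TAutP (endo F).
Proof.
move=> F1 FF; pose M := \matrix_(i, j) mcoeff (mnm1 j) (F i) : 'M[K]_(n + n).
have FE : F = linear_formula M.
  apply/funext => i; rewrite {1}(homog1_expand (F1 i)).
  by apply: eq_bigr => j _; rewrite mxE.
have sM : symplectic M.
  apply/matrixP => i j; apply: oppr_inj.
  have := FF i j; rewrite FE bracket_linear_formula bracket_gen.
  by move=> /(congr1 (mcoeff mnm0)); rewrite !mcoeffZ mcoeff1 eqxx !mulr1.
have [N MN NM] := symplectic_inv sM.
apply: generated_mem; split; last first.
  exists (linear_formula M); first exact: tame_linear.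
  by apply/given_by_poisson => i; rewrite endo_gen FE.
split; last by apply: lrmorphism_symplectic => i j /=; rewrite !endo_gen.
split; first by exists (endo F).
have K' (A B : 'M[K]_(n + n)) : A *m B = 1%:M ->
    cancel (endo (linear_formula A)) (endo (linear_formula B)).
  move=> AB p; apply: (lrmorphism_ext (f := endo _ \o endo _) (g := idfun)) => i.
  by rewrite /= endo_gen endo_linear_formula AB linear_formula1.
by exists (endo (linear_formula N)); rewrite FE; apply: K'.
Qed.

(* For a linear form [u], the time-[c] Hamiltonian flow of u^(k+1) / (k+1); a
   symplectic transvection when [k = 1]. *)
Definition shear (u : P) (c : K) (k : nat) : P -> P :=
  endo (fun i => z i + c *: (pb u (z i) * u ^+ k)).

HB.instance Definition _ u c k := GRing.RMorphism.copy (shear u c k)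
  (endo (fun i => z i + c *: (pb u (z i) * u ^+ k))).
HB.instance Definition _ u c k := GRing.Linear.copy (shear u c k)
  (endo (fun i => z i + c *: (pb u (z i) * u ^+ k))).

Lemma shear_gen u c k i : shear u c k (z i) = z i + c *: (pb u (z i) * u ^+ k).
Proof. exact: endo_gen. Qed.

Lemma shear_homog1 u c k v : v \is homog 1 ->
  shear u c k v = v + c *: (pb u v * u ^+ k).
Proof.
move=> /homog1_expand ->; rewrite /shear !raddf_sum /= mulr_suml scaler_sumr.
rewrite -big_split; apply: eq_bigr => i _ /=.
by rewrite !linearZ /= endo_gen -scalerAl scalerDr scalerA mulrC -scalerA.
Qed.

(** * Shears along a linear form: inverses, symplecticity and tameness *)

Section Shear.
Variable u : P.
Hypothesis u1 : u \is homog 1.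

Lemma bracket_homog1_gen i : pb u (z i) = (mcoeff mnm0 (pb u (z i)))%:A.
Proof. by apply: bracket_homog1 => //; apply: homog_gen. Qed.

Lemma shear_self c k : shear u c k u = u.
Proof. by rewrite shear_homog1 // bracket_self mul0r scaler0 addr0. Qed.

(** The shear fixes [u] and each {u, z_i} is a scalar, so the displacements of two shears along [u]
    with the same exponent add up. *)
Lemma shearK c k : cancel (shear u c k) (shear u (- c) k).
Proof.
move=> p.
apply: (lrmorphism_ext (f := shear u _ k \o shear u _ k) (g := idfun)) => i /=.
rewrite -/(z i) shear_gen raddfD /= linearZ /= rmorphM rmorphXn /= shear_self.
rewrite shear_gen bracket_homog1_gen rmorph_alg -addrA -scalerDl addNr.
by rewrite scale0r addr0.
Qed.

(** With {u, z_i} = a and {u, z_j} = b, the two mixed terms in the bracket of the images are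
    opposite multiples of a b u^(k-1), and the bracket of u^k with itself vanishes. *)
Lemma shear_symplectomorphism c k : symplectomorphism (shear u c k).
Proof.
split.
  split; first by exists (shear u c k).
  by exists (shear u (- c) k); last rewrite -{2}[c]opprK; apply: shearK.
apply: (lrmorphism_symplectic (f := shear u c k)) => i j /=; rewrite !shear_gen.
move: (bracket_homog1_gen i) (bracket_homog1_gen j).
move: (mcoeff _ _) (mcoeff _ _) => a b ui uj; rewrite ui uj !mulr_algl !scalerA.
rewrite bracketDl !raddfD /= !bracketZl !linearZ /= bracket_self.
case: k => [|k].
  by rewrite expr0 (bracket_antisym 1) !bracket1r oppr0 !scaler0 !addr0.
rewrite (bracket_antisym (u ^+ _)) !bracket_exp !(bracket_antisym _ u).
rewrite ui uj !(mulNr, mulr_algl, scalerN, opprK, scaler0, scalerA, addr0).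
rewrite -addrA -scaleNr -scalerDl [X in X *: _](_ : _ = 0); last by ring.
by rewrite scale0r addr0.
Qed.

Lemma TAutP_shear_linear c : TAutP (shear u c 1).
Proof.
have [_ sympl] := shear_symplectomorphism c 1.
apply: TAutP_linear => [i|i j].
  rewrite expr1 bracket_homog1_gen mulr_algl.
  by rewrite rpredD ?homog_gen // !rpredZ.
rewrite -!/(shear u c 1 _).
by rewrite -!shear_gen -sympl bracket_gen rmorph_alg.
Qed.
End Shear.

(** The bracket of x_(i0) with a generator vanishes except at p_(i0), so only that generator moves.
    A positive exponent keeps the added power free of a constant term. *)
Lemma TAutP_shear_gen (i0 : 'I_n) c k : TAutP (shear (z (lshift n i0)) c k.+1).
Proof.
set x := z _; pose m := mnm_muln (mnm1 (lshift n i0)) k.+1.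
have xE : x ^+ k.+1 = mpolyX K m by rewrite mpolyXn.
apply: generated_mem; split.
  by apply: shear_symplectomorphism; apply: homog_gen.
(* The sign of [- c] is that of {x_(i0), p_(i0)} = -1. *)
exists (elementary_formula (rshift n i0) 1 (- c *: x ^+ k.+1)).
  apply: tame_elementary => [||]; first exact: oner_neq0.
    move=> m'; rewrite xE => /msuppZ_le; rewrite msuppX inE => /eqP ->.
    by rewrite mulmnE mnm1E eq_lrshift.
  by rewrite xE mcoeffZ mcoeffX -mdeg_eq0 mdegMn mdeg1 mulr0.
apply/given_by_poisson => i; rewrite shear_gen bracket_genl mderiv_gen.
rewrite /conj_idx /conj_sgn split_lshift /elementary_formula eq_sym.
case: eqP => [->|_]; last by rewrite scaler0 mul0r scaler0 addr0.
by rewrite scale1r scaleN1r mulN1r scalerN scaleNr.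
Qed.

Lemma TAutP_shear (i0 : 'I_n) l c k : l \is homog 1 ->
  pb l (z (lshift n i0)) != 0 -> TAutP (shear l c k.+1).
Proof.
move=> l1; set x := z _ => lx0.
have x1 : x \is homog 1 by apply: homog_gen.
pose b := mcoeff mnm0 (pb l x).
have lxE : pb l x = b%:A by exact: bracket_homog1_gen.
have b0 : b != 0 by apply: contraNN lx0 => /eqP b0; rewrite lxE b0 scale0r.
(* Since {l - x, x} = b, the transvection along [l - x] with coefficient 1 / b adds [l - x] to [x],
   hence sends [x] to [l]. *)
pose u := l - x; have u1 : u \is homog 1 by apply: rpredB.
pose T := shear u b^-1 1; pose T' := shear u (- b^-1) 1.
have [_ sT] := shear_symplectomorphism u1 b^-1 1.
have Tx : T x = l.
  rewrite /T shear_homog1 // bracketDl bracketNl bracket_self subr0 lxE.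
  by rewrite mulr_algl scalerA mulVf // scale1r expr1 addrC subrK.
have TT' : cancel T' T by rewrite /T -[b^-1]opprK; apply: shearK.
suff -> : shear l c k.+1 = T \o shear x c k.+1 \o T'.
  apply: generated_comp; last exact: TAutP_shear_linear.
  by apply: generated_comp; [exact: TAutP_shear_linear | exact: TAutP_shear_gen].
apply/funext => p.
apply: (lrmorphism_ext (f := shear _ _ _) (g := T \o shear x c k.+1 \o T')) => i.
rewrite /= -/(z i) shear_gen.
(* [T'] sends generators to linear forms, where the shear formula still applies; [T] then carries
   {x, T'(z_i)} to {l, z_i} and [x] to [l]. *)
rewrite [shear x _ _ _]shear_homog1; last first.
  rewrite /T' shear_gen (bracket_homog1_gen u1) mulr_algl expr1.
  by rewrite rpredD ?homog_gen // !rpredZ.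
by rewrite /T raddfD /= linearZ /= rmorphM rmorphXn /= sT -/T TT' Tx.
Qed.

End Symplectic.

(** * Tame approximation in characteristic zero *)

Section Approximation.
Context (K : fieldType) (n : nat).
Hypothesis charK : [pchar K] =i pred0.
Local Notation P := (poisson_alg K n).
Local Notation z := (@poisson_gen K n).
Local Notation pb := (@poisson_bracket K n).
Implicit Types (p q r h : P) (phi psi : P -> P).

Lemma natrS_neq0 k : k.+1%:R != 0 :> K.
Proof. by move/pcharf0P: charK => ->. Qed.

(** Subtracting 2^m times the value at t from the value at 2t cancels the term of degree m and
    multiplies that of degree j by 2^j - 2^m, which is nonzero in characteristic 0. Induction yields
    the lower coefficients, and the value at t = 1 then yields the top one. *)
Lemma coef_interpolation (V : lmodType K) (Q : V -> Prop) (m : nat) (v : nat -> V) :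
  Q 0 -> (forall a b, Q a -> Q b -> Q (a + b)) ->
  (forall (c : K) a, Q a -> Q (c *: a)) ->
  (forall t : nat, Q (\sum_(j < m) t%:R ^+ j *: v j)) ->
  forall j, (j < m)%N -> Q (v j).
Proof.
move=> Q0 QD QZ; elim: m v => // m IHm v Qv.
have Qlow j : (j < m)%N -> Q (v j).
  move=> jm; pose c (l : nat) : K := 2%:R ^+ l - 2%:R ^+ m.
  have cj : c j != 0.
    rewrite -oppr_eq0 opprB -!natrX -natrB; last by rewrite leq_exp2l // ltnW.
    have : (0 < 2 ^ m - 2 ^ j)%N by rewrite subn_gt0 ltn_exp2l.
    by case: (_ - _)%N => // e _; apply: natrS_neq0.
  rewrite -[v j]scale1r -(mulVf cj) -scalerA; apply: (QZ _ _).
  apply: (IHm (fun l => c l *: v l)) jm => t.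
  have := QD _ _ (Qv (2 * t)%N) (QZ (- 2%:R ^+ m) _ (Qv t)).
  congr Q; rewrite !big_ord_recr /= scalerDr !scaler_sumr addrACA -big_split /=.
  rewrite scalerA -scalerDl natrM [X in _ + X *: _](_ : _ = 0); last first.
    by rewrite exprMn; ring.
  rewrite scale0r addr0; apply: eq_bigr => l _.
  by rewrite !scalerA -scalerDl /c exprMn; congr (_ *: _); ring.
move=> j; rewrite ltnS leq_eqVlt => /orP [/eqP ->|]; last exact: Qlow.
have -> : v m = \sum_(j < m.+1) 1%:R ^+ j *: v j + -1 *: \sum_(j < m) v j.
  rewrite big_ord_recr /= !expr1n scale1r scaleN1r.
  under eq_bigr do rewrite expr1n scale1r.
  by rewrite addrAC subrr add0r.
apply: (QD _ _); first exact: Qv.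
by apply: (QZ _ _); elim/big_ind: _ => // i _; apply: Qlow.
Qed.

(** Hamiltonians whose infinitesimal flow is the displacement of tame automorphisms, up to errors of
    order k + 3. Quantifying over the time [c] builds in stability under scaling, so that they form
    a linear space. The offset 3 leaves out quadratic Hamiltonians, whose flows are linear. *)
Definition realizable (k : nat) (h : P) : Prop :=
  h \is a mideal k.+3 /\
  forall c, exists2 phi, TAutP phi &
    forall i, phi (z i) - z i - c *: pb h (z i) \is a mideal k.+3.

Lemma mideal_bracket_gen k h i : h \is a mideal k.+1 -> pb h (z i) \is a mideal k.
Proof.
by move=> hh; rewrite -[k]addn0; apply: (bracket_mideal hh (mideal_gen _ _)).
Qed.

Lemma realizable0 k : realizable k 0.
Proof.
split=> [|c]; first exact: rpred0.
exists id => [|i]; first exact: generated_id.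
by rewrite subrr bracket_antisym raddf0 oppr0 scaler0 subr0 rpred0.
Qed.

Lemma realizableZ k a h : realizable k h -> realizable k (a *: h).
Proof.
move=> [hh rh]; split=> [|c]; first exact: rpredZ.
have [phi tphi phih] := rh (c * a); exists phi => // i.
by rewrite bracketZl scalerA.
Qed.

(** Displacements add under composition up to higher order: the displacement [w] of [phi2] has order
    k + 2, and [phi1], which is the identity up to order k + 2, changes [w] only from order 2 k + 3
    on. *)
Lemma realizableD k h1 h2 :
  realizable k h1 -> realizable k h2 -> realizable k (h1 + h2).
Proof.
move=> [hh1 rh1] [hh2 rh2]; split=> [|c]; first exact: rpredD.
have [phi1 t1 e1] := rh1 c; have [phi2 t2 e2] := rh2 c.
exists (phi1 \o phi2) => [|i /=]; first exact: generated_comp.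
have near phi h j : h \is a mideal k.+3 ->
    phi (z j) - z j - c *: pb h (z j) \is a mideal k.+3 ->
    phi (z j) - z j \is a mideal k.+2.
  move=> hh e; rewrite -(subrK (c *: pb h (z j)) (_ - _)).
  apply: rpredD; first exact: midealW e.
  by apply: rpredZ; apply: mideal_bracket_gen.
have [[[[f1 f1E] _] _] _] := TAutP_symplectic t1.
have n1 j : f1 'Y_j - 'Y_j \is a mideal k.+2.
  by rewrite f1E; apply: near hh1 (e1 j).
set w := phi2 (z i) - z i.
have wk : w \is a mideal k.+2 by apply: near hh2 (e2 i).
have -> : phi1 (phi2 (z i)) - z i - c *: pb (h1 + h2) (z i) =
  (f1 w - w) + (phi1 (z i) - z i - c *: pb h1 (z i)) + (w - c *: pb h2 (z i)).
  rewrite bracketDl scalerDr /w raddfB /= !f1E; ring.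
apply: rpredD; last exact: e2.
apply: rpredD; last exact: e1.
by apply: midealW (lrmorphism_near_id n1 wk); rewrite addnS ltnS leq_addr.
Qed.

(** * Polarization: from powers of linear forms to homogeneous Hamiltonians *)

Section Powers.
Variable i0 : 'I_n.
Local Notation x0 := (z (lshift n i0)).

Lemma realizable_power k l : l \is homog 1 -> pb l x0 != 0 ->
  realizable k (l ^+ k.+3).
Proof.
move=> l1 lx; split=> [|c].
  by have := mideal_exp k.+3 (mideal_homog l1); rewrite mul1n.
(* Exponent and coefficient come from {l^(k+3), z_i} = (k+3) {l, z_i} l^(k+2); the error is exactly
   zero. *)
exists (shear l (c * k.+3%:R) k.+2) => [|i]; first exact: TAutP_shear lx.
rewrite shear_gen (bracket_antisym (l ^+ _)) bracket_exp (bracket_antisym (z i) l).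
by rewrite mulNr scalerN opprK scalerA [z i + _]addrC addrK scalerN subrr rpred0.
Qed.

(* Stable under addition of natural multiples of the generators, while the
   bracket with x_(i0) never vanishes: this provides enough interpolation nodes
   to polarize powers of good forms. *)
Definition good_form (l : P) : Prop :=
  l \is homog 1 /\ exists b : nat, pb l x0 = b.+1%:R.

Lemma bracket_gen_x0 i : pb (z i) x0 = (i == rshift n i0)%:R.
Proof.
rewrite bracket_genr mderiv_gen /conj_idx /conj_sgn split_lshift eq_sym opprK.
by rewrite scale1r.
Qed.

Lemma good_formD l i (t : nat) : good_form l -> good_form (l + t%:R *: z i).
Proof.
move=> [l1 [b lb]]; split; first by rewrite rpredD // rpredZ // homog_gen.
exists (b + t * (i == rshift n i0))%N.
rewrite bracketDl bracketZl lb bracket_gen_x0 scaler_nat -addSn natrD mulnC.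
by rewrite natrM mulr_natr.
Qed.

(** In (l + t z_i)^(e+1) X^m, realizable for every natural t by induction, the coefficient of t is
    (e+1) l^e z_i X^m. The statement is general in [l] so that the induction can pass to the forms l
    + t z_i. *)
Lemma realizable_monomial k (m : multinom (n + n)) e l :
  (e + mdeg m = k.+3)%N -> good_form l -> realizable k (l ^+ e * mpolyX K m).
Proof.
elim/mnm_ind: m e l => [|i m IHm] e l.
  rewrite mdeg0 addn0 mpolyX0 mulr1 => -> [l1 [b lb]].
  by apply: realizable_power => //; rewrite lb -mpolyC_nat mpolyC_eq0 natrS_neq0.
rewrite mdegD mdeg1 addnCA add1n -addSn => em lg.
pose v j := ('C(e.+1, j)%:R : K) *: (l ^+ (e.+1 - j) * z i ^+ j * mpolyX K m).
suff : realizable k (v 1%N).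
  move/(realizableZ e.+1%:R^-1); rewrite /v bin1 scalerA mulVf ?natrS_neq0 //.
  by rewrite scale1r subSS subn0 expr1 mpolyXD -mulrA.
apply: (@coef_interpolation _ _ e.+2) => //; first exact: realizable0.
- exact: realizableD.
- by move=> c a; apply: realizableZ.
move=> t; have := IHm _ _ em (good_formD i t lg).
congr realizable; rewrite exprDn mulr_suml; apply: eq_bigr => j _.
rewrite /v exprZn -scalerAr -scaler_nat -!scalerAl !scalerA.
by congr (_ *: _); rewrite mulrC.
Qed.

Lemma realizable_homog k h : h \is homog k.+3 -> realizable k h.
Proof.
move=> hh; rewrite (mpolyE h) big_seq.
elim/big_ind: _ => [||m mh]; [exact: realizable0 | exact: realizableD |].
(* The zeroth power of p_(i0) serves as initial power of a good form; the witness 0 encodes {p_(i0),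
   x_(i0)} = 1. *)
apply: realizableZ; rewrite -[mpolyX _ _]mul1r -(expr0 (z (rshift n i0))).
apply: realizable_monomial; first exact: (dhomogP _ _ _ hh _ mh).
by split; [exact: homog_gen | exists 0%N; rewrite bracket_gen_x0 eqxx].
Qed.
End Powers.

(* The Poincare lemma for the closed one-form [\sum_k g k dz_k]. *)
Lemma hamiltonian_exists k (f : 'I_(n + n) -> P) :
  (forall i, f i \is homog k.+1) ->
  (forall i j, pb (z i) (f j) + pb (f i) (z j) \is a mideal k.+1) ->
  exists2 h, h \is homog k.+2 & forall i, pb h (z i) = f i.
Proof.
(* As {h, z_i} is a signed derivative of [h] in the conjugate variable, [g] lists the partial
   derivatives that [h] must have. *)
move=> fk fz; pose g i := conj_sgn K i *: f (conj_idx i).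
have gk i : g i \is homog k.+1 by apply: rpredZ.
(* The sum of brackets is homogeneous of degree [k] and has order at least k + 1, so it vanishes. *)
have closed i j : mderiv j (g i) = mderiv i (g j).
  have /mideal_homog_eq0 : pb (z (conj_idx i)) (f (conj_idx j)) +
      pb (f (conj_idx i)) (z (conj_idx j)) \is homog k.
    rewrite bracket_genl bracket_genr.
    by apply: rpredD; apply: rpredZ; apply: (mderiv_homog _ (fk _)).
  move/(_ (fz _ _)); rewrite bracket_genl bracket_genr !conj_idxK !conj_sgn_conj.
  rewrite opprK /g !mderivZ scaleNr addrC => /eqP; rewrite subr_eq0 => /eqP E.
  rewrite -[conj_sgn K i]mulr1 -(conj_sgn_sqr K j) mulrA -scalerA E scalerA.
  by rewrite mulrAC conj_sgn_sqr mul1r.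
(* Differentiating the sum gives [g j] plus, by closedness and Euler's identity, k + 1 times [g j];
   whence the factor 1 / (k + 2). *)
pose h := k.+2%:R^-1 *: \sum_i z i * g i.
have dh j : mderiv j h = g j.
  rewrite /h mderivZ (raddf_sum (mderiv j)) /=.
  under eq_bigr => i _ do rewrite mderivM mderiv_gen closed.
  rewrite big_split /= (bigD1 j) //= eqxx mul1r big1 ?addr0 => [|i ij]; last first.
    by rewrite eq_sym (negbTE ij) mul0r.
  rewrite (euler_identity (gk j)) -[X in X + _]scale1r -scalerDl scalerA.
  by rewrite addrC natr1 mulVf ?natrS_neq0 // scale1r.
exists h => [|i].
  apply: rpredZ; apply: rpred_sum => i _.
  exact: (dhomogM (homog_gen _ _) (gk i)).
rewrite bracket_genr dh /g conj_idxK conj_sgn_conj scalerA mulrNN conj_sgn_sqr.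
exact: scale1r.
Qed.

(** * Successive corrections of the displacement *)

(** With g_i the displacement of z_i, preservation of brackets gives {z_i, g_j} + {g_i, z_j} = -
    {g_i, g_j}, of order at least 2 k + 2. The leading part of the displacement therefore satisfies
    the linearized relation, and is Hamiltonian. *)
Lemma tame_correction k (rho : P -> P) : (0 < n)%N -> symplectomorphism rho ->
  (forall i, rho (z i) - z i \is a mideal k.+2) ->
  exists2 phi, TAutP phi & forall i, rho (z i) - phi (z i) \is a mideal k.+3.
Proof.
move=> n0 [[[r rE] _] srho] rk; pose g i := rho (z i) - z i.
pose f i := pihomog (@mdeg (n + n)) k.+2 (g i).
have gf i : g i - f i \is a mideal k.+3 by apply: pihomog_mideal (rk i).
have [i|i j|h hh hf] := @hamiltonian_exists k.+1 f; first exact: pihomogP.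
  have -> : pb (z i) (f j) + pb (f i) (z j) =
      - pb (g i) (g j) - (pb (z i) (g j - f j) + pb (g i - f i) (z j)).
    have gg : pb (g i) (g j) = - (pb (g i) (z j) + pb (z i) (g j)).
      have := srho (z i) (z j); rewrite {1}bracket_gen -rE rmorph_alg -bracket_gen.
      rewrite -[rho (z i)](subrK (z i)) -/(g i) -[rho (z j)](subrK (z j)) -/(g j).
      rewrite !bracketDl !raddfD /= => E.
      by apply: (addIr (pb (z i) (z j))); rewrite {2}E; ring.
    by rewrite gg [pb _ (g j - f j)]raddfB /= bracketDl bracketNl; ring.
  rewrite rpredB ?rpredN //.
    by apply: midealW (bracket_mideal (rk i) (rk j)); rewrite addSnnS leq_addl.
  apply: rpredD; last exact: mideal_bracket_gen.
  by rewrite bracket_antisym rpredN; apply: mideal_bracket_gen.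
(* Positivity of [n] supplies the generators x_1 and p_1 used for polarization; time 1 reproduces
   the whole of [f]. *)
have [_ /(_ 1) [phi tphi e]] := realizable_homog (Ordinal n0) hh.
exists phi => // i; have := rpredB (gf i) (e i).
rewrite hf scale1r; suff -> : rho (z i) - phi (z i) =
  g i - f i - (phi (z i) - z i - f i) by [].
by rewrite /g; ring.
Qed.

(** Brackets of linear parts are constants. They equal the constant terms of {sigma(z_i),
    sigma(z_j)}, since a bracket with a term of order 2 has order at least 1. *)
Lemma tame_linear_part (sigma : P -> P) :
  symplectomorphism sigma -> origin_preserving sigma ->
  exists2 phi, TAutP phi & forall i, sigma (z i) - phi (z i) \is a mideal 2.
Proof.
move=> [[[s sE] _] ssigma] /origin_preservingP o.
pose F i := pihomog (@mdeg (n + n)) 1 (sigma (z i)).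
have F1 i : F i \is homog 1 by apply: pihomogP.
have sF i : sigma (z i) - F i \is a mideal 2 by apply: pihomog_mideal (o i).
exists (endo F) => [|i]; last by rewrite endo_gen.
apply: TAutP_linear => // i j.
have E : pb (z i) (z j) =
    pb (sigma (z i) - F i) (sigma (z j)) + pb (F i) (sigma (z j) - F j) +
    pb (F i) (F j).
  have := ssigma (z i) (z j); rewrite {1}bracket_gen -sE rmorph_alg -bracket_gen.
  by move=> ->; rewrite -addrA -raddfD subrK -bracketDl subrK.
have c0 p : p \is a mideal 1 -> mcoeff mnm0 p = 0.
  by move/midealP; apply; rewrite mdeg0.
rewrite bracket_homog1 // [RHS]bracket_homog1 ?homog_gen // E !mcoeffD.
rewrite (c0 _ (bracket_mideal (sF i) (mideal0 _))).
by rewrite (c0 _ (bracket_mideal (mideal0 (F i)) (sF j))) !add0r.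
Qed.

(** With [psi] inverse to [phi], the composite psi o sigma is the identity up to order k + 2. If
    [phi'] approximates it one order further, so does phi o phi' for [sigma], because
    origin-preserving endomorphisms do not lower orders. *)
Lemma tame_approximation (sigma : P -> P) k : (0 < n)%N ->
  symplectomorphism sigma -> origin_preserving sigma ->
  exists2 phi, TAutP phi & forall i, sigma (z i) - phi (z i) \is a mideal k.+2.
Proof.
move=> n0 ssigma osigma; elim: k => [|k [phi tphi ephi]].
  exact: tame_linear_part.
have [sphi ophi] := TAutP_symplectic tphi.
have [[[f fE] [psi pK qK]] _] := sphi.
have tpsi : TAutP psi by apply: generated_inv tphi pK qK.
have [spsi opsi] := TAutP_symplectic tpsi; have [[[g gE] _] _] := spsi.
have mid (u : {lrmorphism P -> P}) p l : origin_preserving u ->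
    p \is a mideal l -> u p \is a mideal l.
  by move=> /origin_preservingP ou; apply: lrmorphism_mideal.
have gz i : psi (sigma (z i)) - z i \is a mideal k.+2.
  rewrite -{2}(pK (z i)) -!gE -raddfB; apply: mid (ephi i) => j.
  by rewrite gE.
have [phi' tphi' e'] := tame_correction n0 (symplectomorphism_comp spsi ssigma)
  gz.
exists (phi \o phi') => [|i /=]; first exact: generated_comp.
rewrite -[sigma (z i)]qK -!fE -raddfB; apply: mid (e' i) => j.
by rewrite fE.
Qed.

End Approximation.

(** * From orders of vanishing to the metric *)

Lemma height_ge (R : realType) (K : fieldType) (d N : nat) (p : mpoly d K) :
  p \is a mideal N -> ((N%:R : R)%:E <= height R p)%E.
Proof.
move=> /midealP hp; apply: le_ereal_inf_tmp => _ [k pk <-].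
rewrite lee_fin ler_nat leqNgt; apply: contraNN pk => kN.
apply/eqP/mpolyP => m; rewrite mcoeff_pihomog mcoeff0.
by case: eqP => // mk; rewrite hp ?mk.
Qed.

Lemma end_dist_bound (R : realType) (K : fieldType) (n N : nat)
    (phi psi : poisson_alg K n -> poisson_alg K n) :
  (forall i, phi (poisson_gen K i) - psi (poisson_gen K i) \is a mideal N) ->
  0 <= end_dist R phi psi <= expR (- N%:R).
Proof.
move=> h; rewrite /end_dist; set t := tuple_height _ _.
have : ((N%:R : R)%:E <= t)%E.
  rewrite /t /tuple_height; elim/big_ind: _ => [|x y xN yN|i _].
  - exact: leey.
  - by rewrite le_min xN.
  - exact: height_ge.
(* Height +oo gives distance 0, and height -oo contradicts the lower bound. *)
case: t => [r| |] //=; last by rewrite lexx expR_ge0.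
by rewrite lee_fin expR_ge0 ler_expR lerN2.
Qed.

Unset Implicit Arguments.

Theorem theorem1p2p10 (R : realType) (n : nat) (n_gt0 : (0 < n)%N)
    (Phi : (weyl R[i] n -> weyl R[i] n) ->
           (poisson_alg R[i] n -> poisson_alg R[i] n))
    (Phi_iso : tame_isomorphism Phi)
    (sigma : poisson_alg R[i] n -> poisson_alg R[i] n)
    (sigma_symplectic : symplectomorphism sigma)
    (sigma_origin : origin_preserving sigma) :
  exists psi : nat -> (weyl R[i] n -> weyl R[i] n),
    (forall k, TAutW (psi k)) /\
    (fun k => end_dist R (Phi (psi k)) sigma) @ \oo --> (0 : R).
Proof.
have charC : [pchar R[i]] =i pred0 by exact: pchar_num.
have [_ _ Phi_surj] := tame_isomorphism_bij Phi_iso.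
have approx k : exists psi : weyl R[i] n -> weyl R[i] n, TAutW psi /\
    forall i, Phi psi (poisson_gen _ i) - sigma (poisson_gen _ i) \is a mideal k.
  have [phi tphi ephi] :=
    tame_approximation charC k n_gt0 sigma_symplectic sigma_origin.
  have [psi tpsi psiE] := Phi_surj _ tphi.
  exists psi; split=> // i; rewrite psiE -opprB rpredN.
  exact: (midealW (leq_trans (leqnSn k) (leqnSn k.+1)) (ephi i)).
have [psi psiP] := choice approx.
exists psi; split=> [k|]; first by case: (psiP k).
(* The distance is at most exp(-k), hence at most 1 / (k + 1) because exp(k) >= 1 + k. *)
apply: (squeeze_cvgr (f := fun=> 0) (h := @harmonic R)); last exact: cvg_harmonic.
  apply: nearW => k.
  have [_ /(end_dist_bound R) /andP [-> /le_trans ->]] //:= psiP k.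
  rewrite expRN /harmonic /= lef_pV2 ?posrE ?expR_gt0 //.
  by rewrite -natr1 addrC expR_ge1Dx.
exact: cvg_cst.
Qed.
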